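(* For every complex number $q$ with $|q|<1$, $$\sum_{n=0}^{\infty}\sigma\mathrm{Mex}(n)\,q^n=\frac{(-q;q)_\infty}{2(q;q)_\infty}\lim_{z\to -2} z\left(F_1'(z)-qF_1'(qz)\right),$$ where $$F_1(z)=\sum_{n=0}^{\infty}\frac{(-1)^{n}q^{\binom{n}{2}}z^n}{(-q;q)_n}$$ and $F_1'$ denotes the derivative of $F_1$ with respect to its argument $z$ (so $F_1'(qz)$ is $F_1'$ evaluated at $qz$).
   Context: An overpartition of a non-negative integer $n$ is a partition of $n$ (a finite non-increasing sequence of positive integers with sum $n$) in which the first occurrence of each distinct part may or may not be overlined; the empty overpartition is the only overpartition of $0$. Let $\bar{P}(n)$ be the set of all overpartitions of $n$. For $\lambda\in\bar P(n)$, $\mathrm{Mex}(\lambda)$ is the smallest positive integer that does not occur as a part of $\lambda$, whether overlined or non-overlined (so $\mathrm{Mex}$ of the empty overpartition is $1$). Define $\sigma\mathrm{Mex}(n)=\sum_{\lambda\in\bar P(n)}\mathrm{Mex}(\lambda)$. For complex $a,q$ with $|q|<1$, $(a;q)_\infty=\prod_{k=0}^{\infty}(1-aq^k)$ and $(a;q)_n=\prod_{k=0}^{n-1}(1-aq^k)$. The function $F_1(z)$ is the basic hypergeometric series ${}_1\phi_1(q;-q;q,z)$. Here $\binom{n}{2}=n(n-1)/2$ and $q^0=1$. *)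

(* Defs.v *)
From HB Require Import structures.
From mathcomp Require Import all_boot all_order all_algebra.
From mathcomp Require Import complex.
From mathcomp Require Import all_classical all_reals all_analysis.

Set Implicit Arguments.
Unset Strict Implicit.
Unset Printing Implicit Defensive.

Import Order.TTheory GRing.Theory Num.Theory.
Import numFieldNormedType.Exports.

Local Open Scope classical_set_scope.
Local Open Scope ring_scope.

(* MathComp-Analysis puts the topology of the norm on a numFieldType K only
   for variables K and for the alias K^o; this transports it to R[i]. *)
HB.instance Definition _ (R : realType) := NormedModule.copy R[i] R[i]^o.

(* A pair (k, b) is the part k, overlined iff b. *)
Definition parts (l : seq (nat * bool)) : seq nat := [seq p.1 | p <- l].

Definition is_overpartition (n : nat) (l : seq (nat * bool)) : bool :=
  [&& sorted geq (parts l),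
      all (fun k => 0 < k)%N (parts l),
      sumn (parts l) == n
    & all (fun i => (nth (0%N, false) l i).2 ==>
                    (nth 0%N (parts l) i \notin take i (parts l)))
          (iota 0 (size l))].

Definition overpartitions (n : nat) : set (seq (nat * bool)) :=
  [set l | is_overpartition n l].

Lemma mex_exists (l : seq (nat * bool)) :
  exists k, (0 < k)%N && (k \notin parts l).
Proof.
exists (sumn (parts l)).+1 => /=; apply/negP => kl.
have := leqnn (sumn (parts l)).
by rewrite [X in (X <= _)%N]sumnE (big_rem _ kl) /= addSn ltnNge leq_addr.
Qed.

Definition Mex (l : seq (nat * bool)) : nat := ex_minn (mex_exists l).

(* The finitely supported sum below is 0 when infinitely many terms are
   nonzero; this lemma rules that case out. *)
Lemma finite_overpartitions (n : nat) : finite_set (overpartitions n).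
Proof.
pose f (t : n.-bseq ('I_n.+1 * bool)) : seq (nat * bool) :=
  [seq (val p.1, p.2) | p <- t].
apply: (@sub_finite_set _ _ (f @` [set: n.-bseq ('I_n.+1 * bool)])); last first.
  exact/finite_image/finite_finset.
move=> l /= /and4P[_ l_gt0 /eqP l_sum _].
have size_le : (size [seq (inord p.1 : 'I_n.+1, p.2) | p <- l] <= n)%N.
  rewrite size_map -l_sum; elim: l l_gt0 {l_sum} => //= p l IHl /andP[p0 /IHl].
  by move=> lel; rewrite -add1n leq_add.
exists (Bseq size_le) => //; rewrite /f /= -map_comp -[RHS]map_id.
apply/eq_in_map => -[k b] kl /=; rewrite inordK // ltnS -l_sum sumnE.
by rewrite (big_rem k) ?leq_addr //; apply/mapP; exists (k, b).
Qed.

Definition sigmaMex (n : nat) : nat :=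
  \big[addn/0%N]_(l \in overpartitions n) Mex l.

Definition qpoch (R : realType) (a q : R[i]) (n : nat) : R[i] :=
  \prod_(0 <= k < n) (1 - a * q ^+ k).

Definition qpoch_inf (R : realType) (a q : R[i]) : R[i] :=
  lim (qpoch a q @ \oo).

Definition F1_term (R : realType) (q z : R[i]) (n : nat) : R[i] :=
  (-1) ^+ n * q ^+ 'C(n, 2) * z ^+ n / qpoch (- q) q n.

Definition F1 (R : realType) (q z : R[i]) : R[i] :=
  lim (series (F1_term q z) @ \oo).

(* Main.v *)
(* Counting by the condition Mex(lambda) > m, i.e. that 1, ..., m all occur,
   turns sum_n sigmaMex(n) q^n into (-q;q)_oo / (q;q)_oo * sum_m b_m with
   b_m = 2^m q^(m(m+1)/2) / (-q;q)_m.  Concretely, allowing N+1 as a new part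
   multiplies the generating function of the overpartitions with parts at most
   N by 1 + 2 q^(N+1) / (1 - q^(N+1)), and Mex increases by one exactly on those
   with Mex = N+1; letting N tend to infinity is dominated convergence.
   On the other side z (F1'(z) - q F1'(qz)) = sum_n n (1 - q^n) c_n z^n for
   F1(z) = sum_n c_n z^n entire.  At z = -2, with a_n = c_n (-2)^n, one has
   b_n = q^n a_n and a_(n+1) + b_(n+1) = 2 b_n, so sum_n n (a_n - b_n)
   telescopes to 2 sum_n b_n. *)

Require Import Defs.
From mathcomp Require Import all_boot all_order all_algebra.
From mathcomp Require Import complex.
From mathcomp Require Import all_classical all_reals all_analysis.
From mathcomp Require Import ring lra zify.

Set Implicit Arguments.
Unset Strict Implicit.
Unset Printing Implicit Defensive.

Import Order.TTheory GRing.Theory Num.Theory.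
Import numFieldNormedType.Exports.

Local Open Scope classical_set_scope.
Local Open Scope ring_scope.

Local Notation normc := ComplexField.Normc.normc.

(** * Complex sequences and series *)

Section ComplexSequences.
Variable R : realType.
Implicit Types (x y z : R[i]) (u v : nat -> R[i]).

Lemma normc_ge0 x : 0 <= normc x.
Proof. by case: x => a b; exact: sqrtr_ge0. Qed.

Lemma normrE x : `|x| = (normc x)%:C%C.
Proof. by []. Qed.

Lemma normcX x n : normc (x ^+ n) = normc x ^+ n.
Proof.
elim: n => [|n IHn]; first by rewrite !expr0 ComplexField.Normc.normc1.
by rewrite !exprS ComplexField.Normc.normcM IHn.
Qed.

Lemma normc_real (a : R) : normc a%:C%C = `|a|.
Proof. by rewrite /= expr0n addr0 sqrtr_sqr. Qed.

Lemma normc_nat n : normc (n%:R : R[i]) = n%:R.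
Proof. by rewrite -(rmorph_nat (real_complex R)) normc_real normr_nat. Qed.

Lemma le_normc_sum u (m n : nat) :
  normc (\sum_(m <= k < n) u k) <= \sum_(m <= k < n) normc (u k).
Proof.
elim/big_ind2 : _ => //; first by rewrite ComplexField.Normc.normc0.
by move=> x a y b xa yb; apply: le_trans (le_normcD _ _) (lerD _ _).
Qed.

Lemma le_dist_normc x y : `|normc x - normc y| <= normc (x - y).
Proof.
have D a b : normc a - normc b <= normc (a - b).
  by rewrite lerBlDr; have := le_normcD (a - b) b; rewrite subrK.
by rewrite ler_norml D andbT lerNl opprB -[normc (x - y)]normcN opprB D.
Qed.

(** Reverse triangle inequality together with [|q^(k+1)| <= |q|]. The lower bound does not depend on
    [k], so denominators cost only a constant in comparisons with geometric series. *)
Lemma le_normcB1 (q : R[i]) k : normc q < 1 -> 1 - normc q <= normc (1 - q ^+ k.+1).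
Proof.
move=> q1; have := le_dist_normc 1 (q ^+ k.+1).
rewrite ComplexField.Normc.normc1; apply: le_trans; apply: le_trans (ler_norm _).
rewrite lerD2l lerN2 normcX exprS ler_piMr ?normc_ge0 //.
by rewrite exprn_ile1 ?normc_ge0 // ltW.
Qed.

Lemma le_normcD1 (q : R[i]) k : normc q < 1 -> 1 - normc q <= normc (1 + q ^+ k.+1).
Proof.
move=> q1; have := le_dist_normc 1 (- q ^+ k.+1); rewrite opprK normcN.
rewrite ComplexField.Normc.normc1; apply: le_trans; apply: le_trans (ler_norm _).
rewrite lerD2l lerN2 normcX exprS ler_piMr ?normc_ge0 //.
by rewrite exprn_ile1 ?normc_ge0 // ltW.
Qed.

Lemma normc_gt0_neq0 z : 0 < normc z -> z != 0.
Proof. by apply: contraTneq => ->; rewrite ComplexField.Normc.normc0 ltxx. Qed.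

Lemma onemX_neq0 (q : R[i]) k : normc q < 1 -> 1 - q ^+ k.+1 != 0.
Proof.
move=> q1; apply: normc_gt0_neq0; apply: lt_le_trans (le_normcB1 k q1).
by rewrite subr_gt0.
Qed.

Lemma onepX_neq0 (q : R[i]) k : normc q < 1 -> 1 + q ^+ k.+1 != 0.
Proof.
move=> q1; apply: normc_gt0_neq0; apply: lt_le_trans (le_normcD1 k q1).
by rewrite subr_gt0.
Qed.

(** A positive element of [R[i]] has imaginary part zero, so the radii in the complex norm are
    exactly the positive reals and convergence can be tested with real ones. *)
Lemma cvgc_dist_lt T (F : set_system T) {FF : Filter F} (f : T -> R[i]) l :
  f @ F --> l <-> forall e : R, 0 < e -> \forall x \near F, normc (l - f x) < e.
Proof.
split=> [/cvgrPdist_lt fl e e0|fl].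
  have /fl : 0 < e%:C%C by rewrite ltcR.
  by apply: filterS => x; rewrite normrE ltcR.
apply/cvgrPdist_lt => -[e e']; rewrite ltcE /= => /andP[/eqP -> /fl].
by apply: filterS => x; rewrite normrE -[(_ +i* _)%C]/(e%:C)%C ltcR.
Qed.

Lemma cvgc_norm T (F : set_system T) {FF : Filter F} (f : T -> R[i]) l :
  f @ F --> l -> normc (f x) @[x --> F] --> normc l.
Proof.
move=> /cvgc_dist_lt fl; apply/cvgrPdist_lt => e /fl.
by apply: filterS => x; apply: le_lt_trans; exact: le_dist_normc.
Qed.

Lemma cvgc_squeeze T (F : set_system T) {FF : Filter F} (f : T -> R[i])
    (g : T -> R) l :
  (\forall x \near F, normc (l - f x) <= g x) -> g @ F --> 0 -> f @ F --> l.
Proof.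
move=> fg /cvgrPdist_lt g0; apply/cvgc_dist_lt => e /g0 ge.
near=> x; apply: (@le_lt_trans _ _ (g x)); first by near: x.
by apply: le_lt_trans (ler_norm _) _; rewrite -normrN -sub0r; near: x.
Unshelve. all: by end_near. Qed.

Lemma cvgc_lim T (F : set_system T) {FF : ProperFilter F} (f : T -> R[i]) l :
  f @ F --> l -> lim (f @ F) = l.
Proof. exact: (cvg_lim (@norm_hausdorff _ R[i])). Qed.

Lemma cvgc_unique T (F : set_system T) {FF : ProperFilter F}
    (f : T -> R[i]) (l1 l2 : R[i]) :
  f @ F --> l1 -> f @ F --> l2 -> l1 = l2.
Proof. by move=> f1 f2; have <- := cvgc_lim f1; have <- := cvgc_lim f2. Qed.

Lemma cvgc_ReIm T (F : set_system T) {FF : Filter F} (f g : T -> R) (a b : R) :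
  f @ F --> a -> g @ F --> b ->
  (f x +i* g x)%C @[x --> F] --> (a +i* b)%C.
Proof.
move=> fa gb.
apply: (cvgc_squeeze (g := fun t => `|a - f t| + `|b - g t|)).
  near=> x; rewrite (_ : _ - _ = (a - f x)%:C + 'i * (b - g x)%:C)%C; last first.
    by rewrite [RHS]/GRing.add /=; congr (_ +i* _)%C; ring.
  apply: le_trans (le_normcD _ _) _; rewrite ComplexField.Normc.normcM.
  by rewrite !normc_real /= expr0n expr1n add0r sqrtr1 mul1r.
rewrite -[X in _ --> X](addr0 0); apply: cvgD.
  by rewrite -(@normr0 _ R) -(subrr a); apply: cvg_norm; apply: cvgB => //; exact: cvg_cst.
by rewrite -(@normr0 _ R) -(subrr b); apply: cvg_norm; apply: cvgB => //; exact: cvg_cst.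
Unshelve. all: by end_near. Qed.

(** * Absolute summability, infinite products and dominated convergence *)

Definition abs_summable u :=
  exists B : R, forall n, \sum_(0 <= k < n) normc (u k) <= B.

Lemma le_abs_summable u v : (forall n, normc (u n) <= normc (v n)) ->
  abs_summable v -> abs_summable u.
Proof. by move=> uv [B vB]; exists B => n; apply: le_trans (vB n); exact: ler_sum. Qed.

Lemma abs_summableZ x u :
  abs_summable u -> abs_summable (fun n => x * u n).
Proof.
move=> [B uB]; exists (normc x * B) => n.
under eq_bigr do rewrite ComplexField.Normc.normcM.
by rewrite -mulr_sumr ler_wpM2l // normc_ge0.
Qed.

Lemma nondecreasing_bounded_cvg (f : nat -> R) (B : R) :
  {homo f : m n / (m <= n)%N >-> m <= n} -> (forall n, f n <= B) ->
  cvg (f @ \oo).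
Proof.
move=> fh fB; apply: nondecreasing_is_cvgn => //.
by exists B => _ [n _ <-].
Qed.

Lemma sum_nondecreasing (f : nat -> R) : (forall n, 0 <= f n) ->
  {homo (fun n => \sum_(0 <= k < n) f k) : m n / (m <= n)%N >-> m <= n}.
Proof.
move=> f0 m n mn; rewrite (big_cat_nat (leq0n m) mn) /= lerDl.
by rewrite sumr_ge0.
Qed.

(** The real and imaginary parts are dominated by the modulus, so each is an absolutely convergent
    real series; the two limits are then recombined. *)
Lemma abs_summable_cvg u : abs_summable u -> cvg (series u @ \oo).
Proof.
move=> [B uB].
have cvgp (p : R[i] -> R) : (forall x, `|p x| <= normc x) ->
    cvg (series (p \o u) @ \oo).
  move=> px; apply: normed_cvg; apply: nondecreasing_bounded_cvg.
    by apply: sum_nondecreasing => n /=.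
  move=> n; apply: le_trans (uB n); apply: ler_sum => k _; exact: px.
have Rep x : `|complex.Re x| <= normc x.
  by rewrite -lecR -normrE; exact: normc_ge_Re.
have Imp x : `|complex.Im x| <= normc x.
  case: x => a b /=; rewrite -sqrtr_sqr ler_wsqrtr // lerDr; exact: sqr_ge0.
have cRe := cvgp _ Rep; have cIm := cvgp _ Imp.
have := cvgc_ReIm cRe cIm; set l := (_ +i* _)%C => ul.
suff -> : series u = fun n =>
    (series (@complex.Re R \o u) n +i* series (@complex.Im R \o u) n)%C.
  exact: (cvgP _ (ul _)).
apply/funext => n; rewrite /series /=.
elim/big_ind3 : _ => [|x a b y d e -> -> | k _] //=.
by case: (u k).
Qed.

Lemma abs_summable_cvg0 u : abs_summable u -> u @ \oo --> 0.
Proof. by move/abs_summable_cvg; exact: cvg_series_cvg_0. Qed.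

Lemma abs_summable_ratio u :
  (\forall n \near \oo, 2 * normc (u n.+1) <= normc (u n)) -> abs_summable u.
Proof.
move=> [N _ uN]; pose S n := \sum_(0 <= k < n) normc (u k).
(* [S n + 2 |u n|] is non-increasing from [N] on, since the new summand [|u n|] and the new
   [2 |u (n+1)| <= |u n|] together cost at most [2 |u n|]. *)
have S_ub n : (N <= n)%N -> S n + 2 * normc (u n) <= S N + 2 * normc (u N).
  elim: n => [|n IHn]; first by rewrite leqn0 => /eqP ->.
  rewrite leq_eqVlt => /predU1P[-> //|]; rewrite ltnS => Nn.
  have := IHn Nn; have := uN n Nn; rewrite /S big_nat_recr //=.
  lra.
exists (S N + 2 * normc (u N)) => n.
have [Nn|/ltnW nN] := leqP N n.
  by apply: le_trans (S_ub n Nn); rewrite lerDl mulr_ge0 ?normc_ge0.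
apply: (@le_trans _ _ (S N)); last by rewrite lerDl mulr_ge0 ?normc_ge0.
by apply: sum_nondecreasing nN => k; exact: normc_ge0.
Qed.

(** Each factor satisfies [|1 + u k| <= 1 + |u k| <= exp |u k|]. *)
Lemma normc_prod_bounded u : abs_summable u ->
  exists B : R, forall n, normc (\prod_(0 <= k < n) (1 + u k)) <= B.
Proof.
move=> [B uB]; exists (expR B) => n.
apply: (@le_trans _ _ (expR (\sum_(0 <= k < n) normc (u k)))).
  elim: n => [|n IHn].
    by rewrite !big_nil expR0 ComplexField.Normc.normc1.
  rewrite !big_nat_recr //= ComplexField.Normc.normcM expRD.
  apply: ler_pM; rewrite ?normc_ge0 //.
  apply: le_trans (le_normcD _ _) _.
  by rewrite ComplexField.Normc.normc1 expR_ge1Dx.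
by rewrite ler_expR.
Qed.

(** Successive partial products [p n] differ by [p n * u n], so [p] is 1 plus a series, and
    boundedness of [p] makes that series absolutely summable. *)
Lemma cvg_prod u : abs_summable u ->
  cvg ((fun n => \prod_(0 <= k < n) (1 + u k)) @ \oo).
Proof.
move=> su; have [B pB] := normc_prod_bounded su.
pose p n := \prod_(0 <= k < n) (1 + u k).
have B0 : 0 <= B by apply: le_trans (pB 0%N); exact: normc_ge0.
have pu : abs_summable (fun n => p n * u n).
  apply: (@le_abs_summable _ (fun n => B%:C%C * u n)); last exact: abs_summableZ.
  move=> n; rewrite !ComplexField.Normc.normcM normc_real ger0_norm //.
  by rewrite ler_wpM2r ?normc_ge0 ?pB.
have /cvg_ex[l pul] := abs_summable_cvg pu.
change (cvg (p @ \oo)); suff -> : p = fun n => 1 + series (fun n => p n * u n) n.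
  exact: (cvgP _ (cvgD (cvg_cst (1 : R[i])) pul)).
apply/funext => n; rewrite /series /p /=.
elim: n => [|n IHn]; first by rewrite !big_nil addr0.
by rewrite !big_nat_recr //= addrA -IHn mulrDr mulr1.
Qed.

(* Tannery's theorem, for a family that is eventually equal to its limit. *)
Lemma tannery (a : nat -> nat -> R[i]) (b l : nat -> R[i]) (L : R[i]) :
  (forall N n, (n < N)%N -> a N n = b n) ->
  (forall N n, normc (a N n) <= normc (b n)) -> abs_summable b ->
  (forall N, series (a N) @ \oo --> l N) -> l @ \oo --> L ->
  series b @ \oo --> L.
Proof.
move=> ab_eq ab_le [B bB] al lL.
pose S n := \sum_(0 <= k < n) normc (b k).
have S_homo : {homo S : m n / (m <= n)%N >-> m <= n}.
  by apply: sum_nondecreasing => k; exact: normc_ge0.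
have cvgS : cvg (S @ \oo) := nondecreasing_bounded_cvg S_homo bB.
(* Terms of [a N] below index [N] agree with [b], so [l N - series b N] is the tail of [a N] from
   [N] on, which the tail of [sum |b|] dominates. *)
have lb : (fun N => l N - series b N) @ \oo --> 0.
  apply: (cvgc_squeeze (g := fun N => lim (S @ \oo) - S N)); last first.
    by rewrite -(subrr (lim (S @ \oo))); apply: cvgB => //; exact: cvg_cst.
  apply: nearW => N; rewrite sub0r normcN.
  have h : normc (series (a N) J - series b N) @[J --> \oo] -->
      normc (l N - series b N).
    exact: (cvgc_norm (cvgB (al N) (cvg_cst (series b N)))).
  rewrite -(cvg_lim _ h) //; apply: limr_le.
    by apply/cvg_ex; exists (normc (l N - series b N)).
  near=> J.
  have NJ : (N <= J)%N by near: J; exact: nbhs_infty_ge.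
  apply: (@le_trans _ _ (S J - S N)).
    rewrite /series /S /= !(big_cat_nat (leq0n N) NJ) /=.
    rewrite (@eq_big_nat _ _ _ 0%N N (a N) b); last by move=> i; exact: ab_eq.
    rewrite !(addrAC _ _ (- _)) !subrr !add0r.
    by apply: le_trans (le_normc_sum _ _ _) (ler_sum _ _).
  rewrite lerD2r; exact: nondecreasing_cvgn_le.
rewrite -[L]subr0 (_ : series b = fun N => l N - (l N - series b N)).
  exact: (cvgB lL lb).
by apply/funext => N; rewrite opprB addrC subrK.
Unshelve. all: by end_near. Qed.

End ComplexSequences.

(** * Power series *)

Section PowerSeries.
Variable R : realType.
Implicit Types (x y z h q : R[i]) (c u : nat -> R[i]).

Lemma cvg_seriesD_lin (a b x y : R[i]) u v :
  series u @ \oo --> x -> series v @ \oo --> y ->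
  series (fun n => a * u n + b * v n) @ \oo --> a * x + b * y.
Proof.
move=> ux vy; rewrite (_ : series _ = fun n => a * series u n + b * series v n).
  exact: (cvgD (cvgM (cvg_cst a) ux) (cvgM (cvg_cst b) vy)).
by apply/funext => n; rewrite /series /= !mulr_sumr big_split.
Qed.

Lemma normc_lim_series_le u l (B : R) : series u @ \oo --> l ->
  (forall n, \sum_(0 <= k < n) normc (u k) <= B) -> normc l <= B.
Proof.
move=> ul uB; have h : normc (series u n) @[n --> \oo] --> normc l.
  exact: (cvgc_norm ul).
rewrite -(cvg_lim _ h) //; apply: limr_le; first by apply/cvg_ex; exists (normc l).
by apply: nearW => n; apply: le_trans (uB n); exact: le_normc_sum.
Qed.

(** Summability is required at every radius, so factors such as [n] or [4^n] are absorbed by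
    enlarging [z]. *)
Definition entire_coefs c := forall z, abs_summable (fun n => c n * z ^+ n).

Definition psum c z : R[i] := lim (series (fun n => c n * z ^+ n) @ \oo).

(** The termwise derivative. At [n = 0] the power [z ^+ n.-1] is 1, but the multiplicity 0 removes
    the term. *)
Definition dpsum c z : R[i] := lim (series (fun n => c n * (z ^+ n.-1 *+ n)) @ \oo).

Lemma psum_cvg c z : entire_coefs c ->
  series (fun n => c n * z ^+ n) @ \oo --> psum c z.
Proof. by move=> /(_ z) /abs_summable_cvg. Qed.

Lemma abs_summable_dpsum c z : entire_coefs c ->
  abs_summable (fun n => c n * (z ^+ n.-1 *+ n)).
Proof.
(* The factor 2 pays for [n <= 2^n], and [1 + |z| >= 1] pays for the exponent [n - 1] in place of
   [n]. *)
move=> cE; pose r : R := 2 * (1 + normc z).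
apply: (@le_abs_summable _ _ (fun n => c n * r%:C%C ^+ n)); last exact: cE.
move=> n; rewrite !ComplexField.Normc.normcM normcX normc_real.
have r0 : 0 <= r by rewrite mulr_ge0 // addr_ge0 // normc_ge0.
rewrite ler_wpM2l ?normc_ge0 // normcMn normcX ger0_norm // -mulr_natl exprMn.
have n2 : (n <= 2 ^ n)%N by apply: ltnW; exact: ltn_expl.
apply: ler_pM; rewrite ?ler0n ?exprn_ge0 ?normc_ge0 //.
  by rewrite -natrX ler_nat.
have z0 := normc_ge0 z.
apply: (@le_trans _ _ ((1 + normc z) ^+ n.-1)).
  by apply: lerXn2r; rewrite ?nnegrE; lra.
by apply: ler_weXn2l; [lra | exact: leq_pred].
Qed.

Lemma dpsum_cvg c z : entire_coefs c ->
  series (fun n => c n * (z ^+ n.-1 *+ n)) @ \oo --> dpsum c z.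
Proof. by move=> cE; apply: abs_summable_cvg; exact: abs_summable_dpsum. Qed.

(** The remainders satisfy [D_(n+1) = (z + h) D_n + h^2 n z^(n-1)]. With [r = |z| + 1] each summand
    is at most [r (4r)^n |h|^2], and [2r <= 4r] closes the induction. A bound geometric in [n] can
    be summed against entire coefficients. *)
Lemma exprD_taylor1 z h n : normc h <= 1 ->
  normc ((z + h) ^+ n - z ^+ n - h * (z ^+ n.-1 *+ n)) <=
  normc h ^+ 2 * (4 * (normc z + 1)) ^+ n.
Proof.
move=> h1; set r := normc z + 1.
have z0 := normc_ge0 z; have h0 := normc_ge0 h.
have r1 : 1 <= r by rewrite /r; lra.
elim: n => [|n IHn].
  by rewrite !expr0 mulr0n mulr0 subrr subr0 ComplexField.Normc.normc0 mulr1 exprn_ge0.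
set D := (z + h) ^+ n - z ^+ n - h * (z ^+ n.-1 *+ n) in IHn.
have -> : (z + h) ^+ n.+1 - z ^+ n.+1 - h * (z ^+ n *+ n.+1) =
    (z + h) * D + h ^+ 2 * (z ^+ n.-1 *+ n).
  rewrite /D; case: n {D IHn} => [|n] /=; first by rewrite !mulr0n !expr0; ring.
  by rewrite -[_ *+ n.+2]mulr_natr -[_ *+ n.+1]mulr_natr !exprS -(natr1 n.+1); ring.
apply: le_trans (le_normcD _ _) _.
rewrite 2!ComplexField.Normc.normcM normcMn !normcX -[_ *+ n]mulr_natl.
have zr : normc z ^+ n.-1 <= r ^+ n.
  apply: (@le_trans _ _ (r ^+ n.-1)); last by apply: ler_weXn2l => //; exact: leq_pred.
  by apply: lerXn2r; rewrite ?nnegrE /r; lra.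
have zhD : normc (z + h) * normc D <= r * (normc h ^+ 2 * (4 * r) ^+ n).
  apply: ler_pM; rewrite ?normc_ge0 //.
  by apply: le_trans (le_normcD _ _) _; rewrite /r lerD2l.
have nz : n%:R * normc z ^+ n.-1 <= r * (4 * r) ^+ n.
  rewrite exprMn mulrCA; apply: ler_pM => //; rewrite ?exprn_ge0 //.
    by rewrite -natrX ler_nat; apply: ltnW; exact: ltn_expl.
  by apply: le_trans zr _; rewrite ler_peMl // exprn_ge0 //; lra.
apply: le_trans (lerD zhD (ler_wpM2l _ nz)) _; first exact: exprn_ge0.
rewrite [(4 * r) ^+ n.+1]exprS.
have : 0 <= normc h ^+ 2 * (r * (4 * r) ^+ n).
  by rewrite !mulr_ge0 ?exprn_ge0 //; lra.
lra.
Qed.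

(** The termwise remainders are summed using convergence at radius [4 (|z| + 1)]. The quadratic
    error gives both continuity and the derivative of [psum c] at [z]. *)
Lemma psum_taylor1 c z : entire_coefs c -> exists2 B : R, 0 <= B &
  forall h, normc h <= 1 ->
    normc (psum c (z + h) - psum c z - h * dpsum c z) <= B * normc h ^+ 2.
Proof.
move=> cE; set r := 4 * (normc z + 1).
have r0 : 0 <= r by rewrite mulr_ge0 // addr_ge0 // normc_ge0.
have [B cB] := cE r%:C%C; exists B.
  by apply: le_trans (cB 0%N); rewrite big_nil.
move=> h h1.
have l1 := cvg_seriesD_lin (a := 1) (b := -1) (@psum_cvg c (z + h) cE) (@psum_cvg c z cE).
have l2 := cvg_seriesD_lin (a := 1) (b := - h) l1 (@dpsum_cvg c z cE).
rewrite !mul1r mulN1r mulNr in l2.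
apply: (normc_lim_series_le l2) => n; rewrite mulrC.
apply: (@le_trans _ _ (\sum_(0 <= k < n) normc h ^+ 2 * normc (c k * r%:C%C ^+ k))).
  apply: ler_sum => k _.
  rewrite (_ : _ + _ =
      c k * ((z + h) ^+ k - z ^+ k - h * (z ^+ k.-1 *+ k))); last by ring.
  rewrite !ComplexField.Normc.normcM normcX normc_real (ger0_norm r0).
  rewrite mulrCA ler_wpM2l ?normc_ge0 //; exact: exprD_taylor1.
by rewrite -mulr_sumr ler_wpM2l // exprn_ge0 // normc_ge0.
Qed.

Lemma near_normc_lt x (e : R) :
  0 < e -> nbhs x (fun y : R[i] => normc (y - x) < e).
Proof.
move=> e0; have /cvgc_dist_lt/(_ e e0) : (y @[y --> x]) --> x by exact: cvg_id.
by apply: filterS => y; rewrite -normcN opprB.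
Qed.

Lemma cvgc_normB x : (fun y : R[i] => normc (y - x)) @ nbhs x --> 0.
Proof.
apply/cvgrPdist_lt => e /(near_normc_lt x); apply: filterS => y.
by rewrite sub0r normrN ger0_norm ?normc_ge0.
Qed.

Lemma psum_continuous c z : entire_coefs c -> psum c @ nbhs z --> psum c z.
Proof.
move=> cE; have [B B0 cB] := psum_taylor1 z cE.
apply: (cvgc_squeeze
  (g := fun y => normc (y - z) * (B + normc (dpsum c z)))); last first.
  rewrite -[X in _ --> X](mul0r (B + normc (dpsum c z))).
  by apply: cvgM; [exact: cvgc_normB | exact: cvg_cst].
near=> y.
have yz : normc (y - z) <= 1 by apply: ltW; near: y; exact: near_normc_lt.
have := cB _ yz; rewrite [z + _]addrC subrK => yB.
have -> : psum c z - psum c y =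
    - (psum c y - psum c z - (y - z) * dpsum c z + (y - z) * dpsum c z) by ring.
rewrite normcN mulrDr; apply: le_trans (le_normcD _ _) (lerD _ _).
  apply: le_trans yB _; rewrite mulrC ler_wpM2r // expr2 ler_piMl ?normc_ge0 //.
by rewrite ComplexField.Normc.normcM.
Unshelve. all: by end_near. Qed.

Lemma derive1_psum c z : entire_coefs c -> derive1 (psum c) z = dpsum c z.
Proof.
move=> cE; have [B B0 cB] := psum_taylor1 z cE.
apply: cvgc_lim; apply: (cvgc_squeeze (g := fun h => normc h * B)); last first.
  rewrite -[X in _ --> X](mul0r B).
  apply: cvgM; last exact: cvg_cst.
  apply/cvgrPdist_lt => e e0; near=> h.
  rewrite sub0r normrN ger0_norm ?normc_ge0 //; near: h; apply: nbhs_dnbhs.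
  by apply: filterS (near_normc_lt 0 e0) => h; rewrite subr0.
near=> h.
have h0 : h != 0 by near: h; exact: nbhs_dnbhs_neq.
have h1 : normc h <= 1.
  apply: ltW; near: h; apply: nbhs_dnbhs.
  by apply: filterS (near_normc_lt 0 ltr01) => h; rewrite subr0.
have := cB h h1; rewrite [z + h]addrC => hB.
have nh0 : normc h != 0 by apply: contra_neq h0; exact: ComplexField.Normc.eq0_normc.
have -> : dpsum c z - h^-1 *: (psum c (h + z) - psum c z) =
    - (h^-1 * (psum c (h + z) - psum c z - h * dpsum c z)).
  rewrite -[_ *: _]/(_ * _); field; exact: h0.
rewrite normcN ComplexField.Normc.normcM ComplexField.Normc.normcV.
apply: le_trans (ler_wpM2l _ hB) _; first by rewrite invr_ge0 normc_ge0.
by rewrite expr2 mulrCA mulKf // mulrC.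
Unshelve. all: by end_near. Qed.

End PowerSeries.

(** * Overpartitions with bounded parts *)

(** Testing [is_overpartition] at the list's own sum leaves the size free; the bound [J] on it keeps
    the set finite, and [J] later tends to infinity. *)
Definition ovps (N J : nat) : set (seq (nat * bool)) :=
  [set l | [&& is_overpartition (sumn (parts l)) l,
               all (fun k => k <= N)%N (parts l) & (sumn (parts l) < J)%N]].

(* What remains of an overpartition with largest part N after removal of its
   first part. *)
Definition ovps_plain (N J : nat) : set (seq (nat * bool)) :=
  [set l | ovps N J l /\ (N, true) \notin l].

(** The new head is always a first occurrence, whichever way it is marked. In the tail, only an
    overlined copy of [k] loses the right to its overline. *)
Lemma is_overpartition_cons n k b l :
  is_overpartition (k + n) ((k, b) :: l) =
  [&& (0 < k)%N, all (fun j => j <= k)%N (parts l), (k, true) \notin l &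
      is_overpartition n l].
Proof.
rewrite /is_overpartition /= path_sortedE; last exact: rev_trans leq_trans.
rewrite eqn_add2l implybT /=.
have -> : all (geq k) (parts l) = all (fun j => j <= k)%N (parts l) by exact: eq_all.
have -> : all (fun i => (nth (0, false) ((k, b) :: l) i).2 ==>
      (nth 0 (k :: parts l) i \notin take i (k :: parts l))) (iota 1 (size l)) =
    ((k, true) \notin l) && all (fun i => (nth (0, false) l i).2 ==>
      (nth 0 (parts l) i \notin take i (parts l)))%N (iota 0 (size l)).
  rewrite (iotaDl 1 0) all_map.
  have -> : ((k, true) \notin l) =
      all (fun i => nth (0, false) l i != (k, true))%N (iota 0 (size l)).
    rewrite -[in LHS](mkseq_nth (0, false)%N l) /mkseq -has_pred1 -all_predC all_map.
    by apply: eq_all => i /=; rewrite eq_sym.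
  rewrite -all_predI; apply: eq_in_all => i; rewrite mem_iota /= add0n => il.
  rewrite (nth_map (0, false)%N) // inE negb_or.
  by case: (nth _ l i) => j [] //=; rewrite xpair_eqE ?eqxx ?andbT ?andbF.
have perm (a s k0 p e t f : bool) :
    [&& a && s, k0 && p, e, t & f] = [&& k0, a, t, s, p, e & f].
  by case: a; case: k0; case: t; case: s; case: p; case: e.
exact: perm.
Qed.

Lemma ovps_cons N J k b l : ovps N J ((k, b) :: l) =
  [/\ (0 < k)%N, (k <= N)%N & ovps_plain k (J - k) l] :> Prop.
Proof.
rewrite /ovps_plain /ovps /= is_overpartition_cons; apply/propext; split.
  move=> /andP[/and4P[-> lk kl ->] /andP[/andP[-> _] lJ]].
  by split=> //; split=> //; rewrite lk /=; lia.
move=> [-> kN [/and3P[-> lk lJ] ->]]; rewrite lk kN /=; apply/andP; split; last lia.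
by apply: sub_all lk => j jk; exact: leq_trans kN.
Qed.

Lemma ovps_widen N J l : ovps N J l -> ovps N.+1 J l.
Proof.
by move=> /and3P[l1 l2 l3]; apply/and3P; split=> //; apply: sub_all l2 => j /leqW.
Qed.

(* If J <= N.+1 the truncated subtraction gives 0, and both images are empty. *)
Lemma ovpsS N J : ovps N.+1 J = ovps N J `|`
  (cons (N.+1, false) @` ovps_plain N.+1 (J - N.+1) `|`
   cons (N.+1, true) @` ovps_plain N.+1 (J - N.+1)).
Proof.
apply/seteqP; split=> [[|[k b] l] lo|l]; first by left.
  move: (lo); rewrite ovps_cons => -[k0]; rewrite leq_eqVlt => /predU1P[-> lp|].
    by right; case: b {lo}; [right|left]; exists l.
  by rewrite ltnS => kN lp; left; rewrite ovps_cons.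
move=> [/ovps_widen //|[] [l' lp <-]]; by rewrite ovps_cons.
Qed.

(** Without an overlined [N+1], either no part equals [N+1] or the head is a plain [N+1] whose tail
    is of the same kind. This self-reference produces the geometric series for repeated parts. *)
Lemma ovps_plainS N J : ovps_plain N.+1 J =
  ovps N J `|` cons (N.+1, false) @` ovps_plain N.+1 (J - N.+1).
Proof.
apply/seteqP; split=> [l [] | l [lo|[l' lp <-]]].
- rewrite ovpsS => -[|[] [l' lp <-]]; [by left | by move=> _; right; exists l'|].
  by rewrite inE eqxx.
- split; first exact: ovps_widen.
  apply/negP => Nl; case/and3P: lo => _ /allP /(_ N.+1) + _.
  by rewrite ltnn => /(_ (map_f fst Nl)).
- split; first by rewrite ovps_cons.
  by rewrite inE xpair_eqE andbF /=; case: lp.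
Qed.

Lemma finite_ovps N J : finite_set (ovps N J).
Proof.
apply: (@sub_finite_set _ _ (\bigcup_(n in `I_J) overpartitions n)); last first.
  by apply: bigcup_finite => // n _; exact: finite_overpartitions.
by move=> l /and3P[lo _ lJ]; exists (sumn (parts l)).
Qed.

Lemma finite_ovps_plain N J : finite_set (ovps_plain N J).
Proof. by apply: sub_finite_set (finite_ovps N J) => l []. Qed.

Lemma ovps0 N : ovps N 0 = set0.
Proof. by apply/seteqP; split=> l // /and3P[]. Qed.

Lemma ovps0S J : ovps 0 J.+1 = [set [::]].
Proof.
apply/seteqP; split=> [[//|[k b] l]|l ->]; last exact/and3P.
by rewrite ovps_cons leqn0 => -[k0 /eqP kE]; rewrite kE in k0.
Qed.

Lemma mem_cons_plainF N J l b :
  (ovps N J `&` cons (N.+1, b) @` ovps_plain N.+1 (J - N.+1)) l -> False.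
Proof.
by case=> /[swap] -[l' _ <-]; rewrite ovps_cons ltnn => -[].
Qed.

(** * Generating polynomials with a weight on overpartitions *)

Section WeightedSums.
Variables (R : realType) (q : R[i]).
Implicit Types (w : seq (nat * bool) -> nat).

(** The weight is arbitrary so that one recurrence serves both [Mex] and the indicator of a maximal
    [Mex]. *)
Definition wsum w (A : set (seq (nat * bool))) : R[i] :=
  \sum_(l \in A) ((w l)%:R * q ^+ sumn (parts l)).

Lemma wsumU w A B : finite_set A -> finite_set B -> A `&` B `<=` set0 ->
  wsum w (A `|` B) = wsum w A + wsum w B.
Proof. exact: fsbigU0. Qed.

Lemma wsum_cons w k b A : finite_set A ->
  wsum w (cons (k, b) @` A) = q ^+ k * wsum (w \o cons (k, b)) A.
Proof.
move=> fA; rewrite /wsum fsbig_image; last by move=> x y _ _ [].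
rewrite mulr_fsumr; apply: eq_fsbigr => l _ /=.
by rewrite exprD mulrCA.
Qed.

Lemma wsum_ovpsS w N J : wsum w (ovps N.+1 J) = wsum w (ovps N J) +
  q ^+ N.+1 * (wsum (w \o cons (N.+1, false)) (ovps_plain N.+1 (J - N.+1)) +
               wsum (w \o cons (N.+1, true)) (ovps_plain N.+1 (J - N.+1))).
Proof.
have fo := finite_ovps; have fp := finite_ovps_plain.
have fi b : finite_set (cons (N.+1, b) @` ovps_plain N.+1 (J - N.+1)).
  exact: finite_image.
rewrite ovpsS !wsumU ?wsum_cons ?mulrDr //.
- by move=> l [[l' _ <-] [l'' _ []]].
- by rewrite finite_setU.
- by move=> l [lo [] lp]; exact: (mem_cons_plainF (conj lo lp)).
Qed.

Lemma wsum_ovps_plainS w N J : wsum w (ovps_plain N.+1 J) = wsum w (ovps N J) +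
  q ^+ N.+1 * wsum (w \o cons (N.+1, false)) (ovps_plain N.+1 (J - N.+1)).
Proof.
have fo := finite_ovps; have fp := finite_ovps_plain.
rewrite ovps_plainS wsumU ?wsum_cons //; first exact: finite_image.
by move=> l /mem_cons_plainF.
Qed.

Lemma eq_wsum w1 w2 A : {in A, w1 =1 w2} -> wsum w1 A = wsum w2 A.
Proof. by move=> w12; apply: eq_fsbigr => l lA; rewrite w12. Qed.

End WeightedSums.

(** * The effect on [Mex] of a new largest part *)

Lemma MexP l : [/\ (0 < Mex l)%N, Mex l \notin parts l &
  forall j, (0 < j < Mex l)%N -> j \in parts l].
Proof.
rewrite /Mex; case: ex_minnP => m /andP[m0 ml] m_min; split=> // j /andP[j0 jm].
apply: contraLR jm => jl; rewrite -leqNgt; apply: m_min.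
by rewrite j0.
Qed.

Lemma Mex_unique l m : (0 < m)%N -> m \notin parts l ->
  (forall j, (0 < j < m)%N -> j \in parts l) -> Mex l = m.
Proof.
move=> m0 ml mP; have [M0 Ml MP] := MexP l.
by case: (ltngtP (Mex l) m) => // h; [rewrite mP ?M0 in Ml | rewrite MP ?m0 in ml].
Qed.

Lemma eq_Mex l1 l2 : parts l1 =i parts l2 -> Mex l1 = Mex l2.
Proof.
move=> l12; have [M0 Ml MP] := MexP l2.
by apply: Mex_unique => // [|j jM]; rewrite l12 // MP.
Qed.

Lemma Mex_nil : Mex [::] = 1%N.
Proof. by apply: Mex_unique => // j; case: j => [|[]]. Qed.

Lemma Mex_ovps N J l : ovps N J l -> (Mex l <= N.+1)%N.
Proof.
case/and3P=> _ /allP lN _; have [M0 Ml MP] := MexP l.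
rewrite leqNgt; apply/negP => NM.
have /lN : N.+1 \in parts l by rewrite MP //=.
by rewrite ltnn.
Qed.

(** Inserting [N+1] matters only if it was the missing value. Then [N+2] is the next one missing,
    because the parts of [l] are at most [N]. *)
Lemma Mex_cons N J b l : ovps N J l ->
  Mex ((N.+1, b) :: l) = (Mex l + (Mex l == N.+1))%N.
Proof.
move=> lo; have := Mex_ovps lo; case/and3P: lo => _ /allP lN _.
have [M0 Ml MP] := MexP l; rewrite leq_eqVlt => /predU1P[ME|MN].
  rewrite ME eqxx addn1; apply: Mex_unique => //.
    by rewrite inE negb_or -[X in X == _]addn1 -[X in _ == X]addn0 eqn_add2l /=;
      apply/negP => /lN; rewrite ltnNge leqnSn.
  move=> j /andP[j0]; rewrite ltnS leq_eqVlt inE => /predU1P[->|jN].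
    by rewrite eqxx.
  by rewrite MP ?orbT // j0 ME.
rewrite (ltn_eqF MN) addn0; apply: Mex_unique => //.
  by rewrite inE negb_or Ml andbT neq_ltn MN.
by move=> j /MP jl; rewrite inE jl orbT.
Qed.

(** * Limits of sequences satisfying a contracting recurrence with delay *)

Section LimitRecurrence.
Variable R : realType.

Lemma contracting_cvg0 (x e : nat -> R) (r : R) k :
  (0 < k)%N -> 0 <= r -> r < 1 -> (forall n, 0 <= x n) ->
  (forall n, x n <= e n + r * x (n - k)%N) -> e @ \oo --> 0 -> x @ \oo --> 0.
Proof.
move=> k0 r0 r1 x0 xe e0.
have [E eE] : exists E, forall n, e n <= E.
  have /cvg_seq_bounded/bounded_fun_has_ubound[E eE] : cvg (e @ \oo).
    by apply/cvg_ex; exists 0.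
  by exists E => n; apply: eE; exists n.
(* [|E| / (1 - r)] is the fixed point of [t -> |E| + r t], and [x 0] starts the induction. For
   [n < k] the truncated [n - k] is 0, so the bound at 0 is the one used. *)
pose M := `|E| / (1 - r) + x 0%N.
have M_E : E + r * M <= M.
  rewrite -lerBrDr -[X in _ <= X - _]mul1r -mulrBl /M mulrDr mulrCA divff ?mulr1.
    apply: le_trans (ler_norm E) _; rewrite lerDl mulr_ge0 // subr_ge0; exact: ltW.
  by rewrite subr_eq0 gt_eqF.
have xM n : x n <= M.
  elim/ltn_ind: n => -[_|n IHn].
    by rewrite /M lerDr divr_ge0 // subr_ge0 ltW.
  apply: le_trans (xe _) (le_trans _ M_E); apply: lerD => //.
  by rewrite ler_wpM2l // IHn //; lia.
have M0 : 0 <= M by apply: le_trans (xM 0%N).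
(* One more round of the inequality, with [e n <= (1 - r) d] eventually, gives [(1 - r) d + r (d +
   r^m M) = d + r^(m+1) M]. *)
have xm (d : R) (m : nat) : 0 < d ->
    \forall n \near \oo, x n <= d + r ^+ m * M.
  move=> d0; elim: m => [|m [J _ xJ]].
    by apply: nearW => n; rewrite expr0 mul1r (le_trans (xM n)) // lerDr ltW.
  have d'0 : 0 < (1 - r) * d by rewrite mulr_gt0 // subr_gt0.
  near=> n.
  apply: le_trans (xe n) _.
  have en : e n <= (1 - r) * d.
    apply: le_trans (ler_norm _) _; rewrite -normrN -sub0r ltW //.
    by near: n; move/cvgrPdist_lt : e0; exact.
  have xn : x (n - k)%N <= d + r ^+ m * M.
    apply: xJ => /=; rewrite leq_subRL; last by near: n; exact: nbhs_infty_ge.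
    by near: n; exact: nbhs_infty_ge.
  have := ler_wpM2l r0 xn; rewrite exprS; lra.
apply/cvgrPdist_lt => d d0.
have rM : (fun m => r ^+ m * M) @ \oo --> 0.
  rewrite -[X in _ --> X](mul0r M); apply: cvgM; last exact: cvg_cst.
  by apply: cvg_expr; rewrite ger0_norm.
have d2 : 0 < d / 3 by rewrite divr_gt0.
move/cvgrPdist_lt : rM => /(_ _ d2) [m _ /(_ m (leqnn m))] /=.
rewrite sub0r normrN ger0_norm ?mulr_ge0 ?exprn_ge0 // => md.
near=> n; rewrite sub0r normrN ger0_norm //.
have : x n <= d / 3 + r ^+ m * M by near: n; exact: xm.
lra.
Unshelve. all: by end_near. Qed.

(** The limit [L] solves [L = A + c L], so [L - u n] obeys the same recurrence with source
    [A - f n], which tends to 0. *)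
Lemma cvg_linear_rec (u f : nat -> R[i]) (c A : R[i]) k :
  (0 < k)%N -> normc c < 1 -> (forall n, u n = f n + c * u (n - k)%N) ->
  f @ \oo --> A -> u @ \oo --> A / (1 - c).
Proof.
move=> k0 c1 uf fA; set L := A / (1 - c).
have c_neq1 : 1 - c != 0.
  apply: contraTneq c1 => /eqP; rewrite subr_eq0 => /eqP <-.
  by rewrite ComplexField.Normc.normc1 ltxx.
have LE : L = A + c * L by rewrite /L; field; exact: c_neq1.
apply: (cvgc_squeeze (g := fun n => normc (L - u n))); first by apply: nearW => n.
apply: (contracting_cvg0 (e := fun n => normc (A - f n)) (r := normc c) k0) => //.
- exact: normc_ge0.
- by move=> n; exact: normc_ge0.
- move=> n; rewrite -ComplexField.Normc.normcM.
  rewrite (_ : L - u n = (A - f n) + c * (L - u (n - k)%N)) ?le_normcD //.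
  by rewrite {1}LE uf; ring.
apply/cvgrPdist_lt => d d0; move/cvgc_dist_lt : fA => /(_ _ d0).
by apply: filterS => n; rewrite sub0r normrN ger0_norm // normc_ge0.
Qed.

End LimitRecurrence.

(** * Generating functions with parts at most [N] *)

Section TruncatedSeries.
Variables (R : realType) (q : R[i]).
Hypothesis q1 : normc q < 1.

Let qk_lt1 k : normc (q ^+ k.+1) < 1.
Proof. by rewrite normcX exprn_ilt1 // normc_ge0. Qed.

(** The first copy of [N+1], plain or overlined, gives [2 q^(N+1)]. Further copies are plain and do
    not change the weight, which depends only on the set of parts, so they contribute
    [1 / (1 - q^(N+1))]. *)
Lemma cvg_wsum_ovpsS (w : seq (nat * bool) -> nat) N (A B : R[i]) :
  (forall l1 l2, parts l1 =i parts l2 -> w l1 = w l2) ->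
  wsum q w (ovps N J) @[J --> \oo] --> A ->
  wsum q (w \o cons (N.+1, false)) (ovps N J) @[J --> \oo] --> B ->
  wsum q w (ovps N.+1 J) @[J --> \oo] -->
    A + 2 * q ^+ N.+1 / (1 - q ^+ N.+1) * B.
Proof.
move=> wP wA wB; set k := N.+1; set w' := w \o cons (k, false).
pose u J := wsum q w' (ovps_plain k J).
have uB : u @ \oo --> B / (1 - q ^+ k).
  apply: (cvg_linear_rec (k := k) _ (qk_lt1 N) _ wB) => // J.
  rewrite /u wsum_ovps_plainS; congr (_ + _ * _).
  by apply: eq_wsum => l _ /=; apply: wP => j; rewrite !inE orbA orbb.
have ukB : (fun J => u (J - k)%N) @ \oo --> B / (1 - q ^+ k).
  apply: cvg_comp uB; exact: cvg_subnr.
rewrite (_ : (fun J => _) = fun J => wsum q w (ovps N J) + 2 * q ^+ k * u (J - k)%N).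
  rewrite -[2 * _ / _ * B]mulrA [_^-1 * B]mulrC.
  exact: (cvgD wA (cvgM (cvg_cst (2 * q ^+ k)) ukB)).
apply/funext => J; rewrite wsum_ovpsS -/k -/w' (_ : wsum q (w \o _) _ = u (J - k)%N).
  by rewrite -/(u _); ring.
by apply: eq_wsum => l _; apply: wP => j; rewrite !inE.
Qed.

Lemma wsum_ovps0 (w : seq (nat * bool) -> nat) :
  wsum q w (ovps 0 J) @[J --> \oo] --> ((w [::])%:R : R[i]).
Proof.
apply: cvg_near_cst; near=> J.
have J0 : (0 < J)%N by near: J; exact: nbhs_infty_gt.
by rewrite -(prednK J0) ovps0S /wsum fsbig_set1 expr0 mulr1.
Unshelve. all: by end_near. Qed.

(** When all parts are at most [N], this is the indicator that [1, ..., N] all occur. *)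
Definition full (N : nat) (l : seq (nat * bool)) : nat := Mex l == N.+1.

(** [full N.+1] vanishes when the parts are at most [N], and inserting [N+1] turns it into [full N];
    only the product term of the recurrence survives. *)
Lemma cvg_wsum_full N : wsum q (full N) (ovps N J) @[J --> \oo] -->
  \prod_(0 <= k < N) (2 * q ^+ k.+1 / (1 - q ^+ k.+1)).
Proof.
elim: N => [|N IHN].
  rewrite big_nil (_ : 1 = (full 0 [::])%:R); last by rewrite /full Mex_nil.
  exact: wsum_ovps0.
rewrite (_ : \prod_(0 <= k < N.+1) _ = 0 + 2 * q ^+ N.+1 / (1 - q ^+ N.+1) *
    \prod_(0 <= k < N) (2 * q ^+ k.+1 / (1 - q ^+ k.+1))); last first.
  by rewrite big_nat_recr //= add0r mulrC.
apply: cvg_wsum_ovpsS => [l1 l2 /eq_Mex l12||].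
- by rewrite /full l12.
- apply: cvg_near_cst; apply: nearW => J; apply: fsbig1 => l lo.
  have := Mex_ovps lo; rewrite /full; case: eqP => [->|_ _]; last by rewrite mul0r.
  by rewrite ltnn.
- rewrite (_ : (fun J => _) = fun J => wsum q (full N) (ovps N J)) //.
  apply/funext => J; apply: eq_wsum => l /set_mem lo /=.
  rewrite /full (Mex_cons _ lo); congr nat_of_bool; have := Mex_ovps lo.
  by case: (Mex l =P N.+1) => [->|] /=; lia.
Qed.

Lemma cvg_wsum_Mex N : wsum q Mex (ovps N J) @[J --> \oo] -->
  qpoch (- q) q N / qpoch q q N * series (F1_term q (- 2 * q)) N.+1.
Proof.
have qpochS n : qpoch q q n.+1 = qpoch q q n * (1 - q ^+ n.+1).
  by rewrite /qpoch big_nat_recr //= exprS.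
have qpochNS n : qpoch (- q) q n.+1 = qpoch (- q) q n * (1 + q ^+ n.+1).
  by rewrite /qpoch big_nat_recr //= exprS mulNr opprK.
have qpoch_neq0 n : qpoch q q n != 0.
  elim: n => [|n IHn]; first by rewrite /qpoch big_nil oner_neq0.
  by rewrite qpochS mulf_neq0 // onemX_neq0.
have qpochN_neq0 n : qpoch (- q) q n != 0.
  elim: n => [|n IHn]; first by rewrite /qpoch big_nil oner_neq0.
  by rewrite qpochNS mulf_neq0 // onepX_neq0.
(* [F1_term q (- 2 * q) n] is [b_n], since [(-1)^n (-2q)^n q^(n(n-1)/2) = 2^n q^(n(n+1)/2)]. *)
have fullE n : \prod_(0 <= k < n) (2 * q ^+ k.+1 / (1 - q ^+ k.+1)) =
    qpoch (- q) q n / qpoch q q n * F1_term q (- 2 * q) n.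
  rewrite /F1_term; elim: n => [|n IHn].
    by rewrite big_nil /qpoch !big_nil !expr0 !mulr1 divr1 mulr1.
  rewrite big_nat_recr //= IHn binS bin1 !qpochS !qpochNS exprD !exprS.
  have := qpoch_neq0 n; have := qpochN_neq0 n; have := onepX_neq0 n q1.
  have := onemX_neq0 n q1; rewrite !exprS => *; field.
  by apply/and4P.
elim: N => [|N IHN].
  rewrite /series /= big_nat1 -[_ * _]fullE big_nil.
  rewrite (_ : 1 = (Mex [::])%:R); last by rewrite Mex_nil.
  exact: wsum_ovps0.
(* With [x = q^(N+1)], the factor [1 + 2x/(1-x) = (1+x)/(1-x)] advances the prefactor, while
   [2x/(1-x)] extends the product by one factor and so supplies the term of index [N+1]. *)
have E : qpoch (- q) q N.+1 / qpoch q q N.+1 * series (F1_term q (- 2 * q)) N.+2 =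
    qpoch (- q) q N / qpoch q q N * series (F1_term q (- 2 * q)) N.+1 +
    2 * q ^+ N.+1 / (1 - q ^+ N.+1) *
    (qpoch (- q) q N / qpoch q q N * series (F1_term q (- 2 * q)) N.+1 +
     \prod_(0 <= k < N) (2 * q ^+ k.+1 / (1 - q ^+ k.+1))).
  have -> : series (F1_term q (- 2 * q)) N.+2 =
      series (F1_term q (- 2 * q)) N.+1 + F1_term q (- 2 * q) N.+1.
    by rewrite /series /= [LHS]big_nat_recr.
  rewrite mulrDr -fullE [\prod_(0 <= k < N.+1) _]big_nat_recr //= qpochS qpochNS.
  have := onemX_neq0 N q1; have := qpoch_neq0 N; rewrite !exprS => *; field.
  by apply/andP.
rewrite E; apply: cvg_wsum_ovpsS; [exact: eq_Mex | exact: IHN |].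
rewrite (_ : (fun J => _) =
    fun J => wsum q Mex (ovps N J) + wsum q (full N) (ovps N J)).
  exact: (cvgD IHN (@cvg_wsum_full N)).
apply/funext => J; rewrite /wsum -fsbig_split; last exact: finite_ovps.
apply: eq_fsbigr => l /set_mem lo /=.
by rewrite (Mex_cons _ lo) natrD mulrDl.
Qed.

End TruncatedSeries.

(** * The two generating functions *)

(** Cutting off the largest part, not the size, gives the family to which dominated convergence in
    [N] applies. *)
Definition sigmaMex_le (N n : nat) : nat :=
  \big[addn/0%N]_(l \in overpartitions n `&`
                        [set l | all (fun k => k <= N)%N (parts l)]) Mex l.

Lemma sigmaMex_le_leq N n : (sigmaMex_le N n <= sigmaMex n)%N.
Proof.
rewrite /sigmaMex (fsbigID [set l | all (fun k => k <= N)%N (parts l)]) /=.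
  exact: leq_addr.
exact: finite_overpartitions.
Qed.

Lemma sigmaMex_le_eq N n : (n <= N)%N -> sigmaMex_le N n = sigmaMex n.
Proof.
move=> nN; congr (\big[_/_]_(l \in _) _); apply/setIidPl => l /and4P[_ _ /eqP ln _].
apply/allP => k kl; apply: leq_trans nN.
by rewrite -ln sumnE (big_rem _ kl) leq_addr.
Qed.

Section GeneratingFunction.
Variable R : realType.
Implicit Types (q z : R[i]).

(** Grouping by size: raising [J] to [J+1] adds exactly the overpartitions of [J] with parts at most
    [N]. *)
Lemma wsum_MexE q N J : wsum q Mex (ovps N J) =
  series (fun n => (sigmaMex_le N n)%:R * q ^+ n) J.
Proof.
elim: J => [|J IHJ]; first by rewrite ovps0 /wsum fsbig_set0 /series /= big_nil.
rewrite /series /= big_nat_recr //= -[X in X + _]IHJ.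
have finJ : finite_set (overpartitions J `&`
    [set l | all (fun k => k <= N)%N (parts l)]).
  by apply: finite_setIl; exact: finite_overpartitions.
have -> : (sigmaMex_le N J)%:R * q ^+ J = wsum q Mex (overpartitions J `&`
    [set l | all (fun k => k <= N)%N (parts l)]).
  rewrite /sigmaMex_le fsbig_finite // (big_morph _ (@natrD R[i]) (mulr0n _)).
  rewrite -fsbig_finite // mulr_fsuml; apply: eq_fsbigr => l /set_mem[+ _].
  by case/and4P=> _ _ /eqP ->.
rewrite -wsumU //; last 2 first.
- exact: finite_ovps.
- by move=> l [/and3P[_ _ lJ] [/and4P[_ _ /eqP lE _] _]]; rewrite lE ltnn in lJ.
congr wsum; apply/seteqP; split=> [l /and3P[lo lN]|l [/and3P[lo lN lJ]|[lo lN]]].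
- rewrite ltnS leq_eqVlt => /predU1P[lJ|lJ]; [right|left].
    by rewrite -lJ.
  exact/and3P.
- by apply/and3P; split=> //; exact: ltnW.
- by case/and4P: (lo) => _ _ /eqP lJ _; apply/and3P; split=> //; rewrite lJ.
Qed.

Lemma abs_summable_expr q : normc q < 1 -> abs_summable (fun n => q ^+ n).
Proof.
move=> q1; exists (1 - normc q)^-1 => n.
have q1' : 0 < 1 - normc q by rewrite subr_gt0.
rewrite -[leRHS]div1r ler_pdivlMr //.
have -> : (\sum_(0 <= k < n) normc (q ^+ k)) * (1 - normc q) = 1 - normc q ^+ n.
  elim: n => [|n IHn]; first by rewrite big_nil mul0r expr0 subrr.
  by rewrite big_nat_recr //= mulrDl IHn normcX exprS; ring.
by rewrite lerBlDr lerDl exprn_ge0 // normc_ge0.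
Qed.

Lemma qpochE (s : R[i]) q n : qpoch s q n = \prod_(0 <= k < n) (1 + - s * q ^+ k).
Proof. by apply: eq_bigr => k _; rewrite mulNr. Qed.

(** Since [1/(1-x) = 1 + x/(1-x)], the reciprocal is again a product of factors [1 + u k] with [u]
    summable, so it converges and is bounded. *)
Lemma qpochVE q n : normc q < 1 ->
  (qpoch q q n)^-1 = \prod_(0 <= k < n) (1 + q ^+ k.+1 / (1 - q ^+ k.+1)).
Proof.
move=> q1; rewrite /qpoch; elim: n => [|n IHn]; first by rewrite !big_nil invr1.
rewrite !big_nat_recr //= -IHn invfM -exprS; congr (_ * _).
have := onemX_neq0 n q1 => *; field; by [].
Qed.

Lemma abs_summable_qpoch (s : R[i]) q : normc q < 1 ->
  abs_summable (fun k => - s * q ^+ k).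
Proof. by move=> /abs_summable_expr; exact: abs_summableZ. Qed.

Lemma abs_summable_qpochV q : normc q < 1 ->
  abs_summable (fun k => q ^+ k.+1 / (1 - q ^+ k.+1)).
Proof.
move=> q1; apply: (@le_abs_summable _ _ (fun k => ((1 - normc q)^-1)%:C%C * q ^+ k)).
  move=> k; rewrite [normc (_ / _)]ComplexField.Normc.normcM ComplexField.Normc.normcV.
  rewrite [leRHS]ComplexField.Normc.normcM mulrC.
  have q1' : 0 < 1 - normc q by rewrite subr_gt0.
  have qk := le_normcB1 k q1.
  rewrite normc_real ger0_norm; last by rewrite invr_ge0 ltW.
  apply: ler_pM; rewrite ?invr_ge0 ?normc_ge0 //.
    by rewrite lef_pV2 ?posrE // (lt_le_trans q1').
  by rewrite exprS ComplexField.Normc.normcM ler_piMl ?normc_ge0 // ltW.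
by apply: abs_summableZ; exact: abs_summable_expr.
Qed.

Lemma cvg_qpoch (s : R[i]) q : normc q < 1 -> qpoch s q @ \oo --> qpoch_inf s q.
Proof.
move=> q1; have := cvg_prod (abs_summable_qpoch s q1).
rewrite (_ : (fun n => _) = qpoch s q) //.
by apply/funext => n; rewrite qpochE.
Qed.

(** The reciprocals of the partial products converge as well, and the two limits multiply to 1. *)
Lemma qpoch_inf_neq0 q : normc q < 1 -> qpoch_inf q q != 0.
Proof.
move=> q1; apply/eqP => q0.
have /cvg_ex[l ql] := cvg_prod (abs_summable_qpochV q1).
have h : (fun=> 1 : R[i]) @ \oo --> qpoch_inf q q * l.
  rewrite (_ : (fun=> 1) = qpoch q q \*
      (fun n => \prod_(0 <= k < n) (1 + q ^+ k.+1 / (1 - q ^+ k.+1)))).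
    exact: (cvgM (@cvg_qpoch q q q1) ql).
  apply/funext => n /=; rewrite -qpochVE // divff //.
  rewrite /qpoch; elim/big_ind : _ => [|x y|k _]; [exact: oner_neq0|exact: mulf_neq0|].
  by rewrite -exprS onemX_neq0.
have h1 : (fun=> 1 : R[i]) @ \oo --> (1 : R[i]) by exact: cvg_cst.
have e1 : 1 = qpoch_inf q q * l by exact: (cvgc_unique h1 h).
by move/eqP: e1; rewrite q0 mul0r oner_eq0.
Qed.

(** * The function [F1] and its derivative at -2 *)

Definition F1_coef q (n : nat) : R[i] :=
  (-1) ^+ n * q ^+ 'C(n, 2) / qpoch (- q) q n.

Lemma F1_termE q z : F1_term q z = fun n => F1_coef q n * z ^+ n.
Proof. by apply/funext => n; rewrite /F1_term /F1_coef mulrAC. Qed.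

Lemma F1_coefS q n : normc q < 1 ->
  F1_coef q n.+1 = - (q ^+ n / (1 + q ^+ n.+1)) * F1_coef q n.
Proof.
move=> q1; rewrite /F1_coef /qpoch big_nat_recr //= mulNr opprK -exprS.
by rewrite binS bin1 exprD exprS invfM; ring.
Qed.

(** The ratio of consecutive terms is [- q^n z / (1 + q^(n+1))]. It tends to 0 because the
    denominator stays at least [1 - |q|] in modulus. *)
Lemma entire_F1 q : normc q < 1 -> entire_coefs (F1_coef q).
Proof.
move=> q1 z; apply: abs_summable_ratio.
have q1' : 0 < 1 - normc q by rewrite subr_gt0.
have h : (fun n => normc q ^+ n * (2 * normc z / (1 - normc q))) @ \oo --> 0.
  rewrite -[X in _ --> X](mul0r (2 * normc z / (1 - normc q))).
  apply: cvgM; last exact: cvg_cst.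
  by apply: cvg_expr; rewrite ger0_norm // normc_ge0.
near=> n.
have hn : normc q ^+ n * (2 * normc z / (1 - normc q)) <= 1.
  apply: le_trans (ler_norm _) _; rewrite -normrN -sub0r ltW //.
  by near: n; move/cvgrPdist_lt : h; apply; exact: ltr01.
rewrite (_ : F1_coef q n.+1 * z ^+ n.+1 =
    - (q ^+ n * z / (1 + q ^+ n.+1)) * (F1_coef q n * z ^+ n)); last first.
  by rewrite F1_coefS // [z ^+ n.+1]exprS; ring.
rewrite ComplexField.Normc.normcM normcN mulrA ler_piMl ?normc_ge0 //.
apply: le_trans hn.
rewrite ComplexField.Normc.normcM ComplexField.Normc.normcV.
rewrite ComplexField.Normc.normcM normcX.
have -> : 2 * (normc q ^+ n * normc z / normc (1 + q ^+ n.+1)) =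
  normc q ^+ n * (2 * normc z) / normc (1 + q ^+ n.+1) by ring.
rewrite [leRHS]mulrA ler_wpM2l ?mulr_ge0 ?exprn_ge0 ?normc_ge0 //.
have qn := le_normcD1 n q1.
by rewrite lef_pV2 ?posrE // (lt_le_trans q1').
Unshelve. all: by end_near. Qed.

(** Coefficients of [z (F1'(z) - q F1'(qz))]: differentiation brings down [n], and
    [q q^(n-1) = q^n]. *)
Definition G_coef q (n : nat) : R[i] := n%:R * (1 - q ^+ n) * F1_coef q n.

Lemma entire_G q : normc q < 1 -> entire_coefs (G_coef q).
Proof.
(* The outer 2 bounds [|1 - q^n|], and passing from [z] to [2 * z] absorbs [n <= 2^n]. *)
move=> q1 z; apply: (@le_abs_summable _ _ (fun n =>
    2 * (F1_coef q n * (2 * z) ^+ n))); last first.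
  by apply: abs_summableZ; exact: entire_F1.
move=> n; rewrite exprMn (_ : G_coef q n * z ^+ n =
    (1 - q ^+ n) * (n%:R * (F1_coef q n * z ^+ n))); last by rewrite /G_coef; ring.
rewrite (_ : F1_coef q n * (2 ^+ n * z ^+ n)
    = 2 ^+ n * (F1_coef q n * z ^+ n)); last by ring.
rewrite [leLHS]ComplexField.Normc.normcM [leRHS]ComplexField.Normc.normcM.
apply: ler_pM; rewrite ?normc_ge0 //.
  apply: le_trans (le_normcD _ _) _; rewrite normcN normcX.
  rewrite ComplexField.Normc.normc1 (normc_nat _ 2) -[leRHS]/(1 + 1 : R) lerD2l.
  by rewrite exprn_ile1 ?normc_ge0 // ltW.
rewrite [leLHS]ComplexField.Normc.normcM [leRHS]ComplexField.Normc.normcM.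
rewrite ler_wpM2r ?normc_ge0 // normcX !normc_nat -natrX ler_nat.
by apply: ltnW; exact: ltn_expl.
Qed.

Lemma F1_psum q : F1 q = psum (F1_coef q).
Proof. by apply/funext => z; rewrite /F1 F1_termE. Qed.

Lemma G_psum q z : normc q < 1 ->
  z * (derive1 (F1 q) z - q * derive1 (F1 q) (q * z)) = psum (G_coef q) z.
Proof.
move=> q1; have cE := entire_F1 q1.
rewrite F1_psum !derive1_psum //.
have l1 := cvg_seriesD_lin (a := z) (b := - (z * q))
  (@dpsum_cvg _ _ z cE) (@dpsum_cvg _ _ (q * z) cE).
rewrite mulrBr mulrA -mulNr; apply: cvgc_unique l1 _.
rewrite (_ : (fun n => _) = fun n => G_coef q n * z ^+ n).
  by apply: psum_cvg; exact: entire_G.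
apply/funext => -[|n]; first by rewrite /G_coef !mulr0n !(mulr0, mul0r) addr0.
rewrite /G_coef /= -[_ *+ n.+1]mulr_natr -[(q * z) ^+ n *+ n.+1]mulr_natr.
by rewrite exprMn !exprS; ring.
Qed.

(** The left side is [a_(n+1) (1 + q^(n+1))], and the coefficient recurrence cancels this factor,
    leaving [2 q^n a_n = 2 b_n]. *)
Lemma F1_term_recur q n : normc q < 1 ->
  F1_term q (- 2) n.+1 + F1_term q (- 2 * q) n.+1 = 2 * F1_term q (- 2 * q) n.
Proof.
move=> q1; rewrite !F1_termE F1_coefS // !exprMn !exprS.
by have := onepX_neq0 n q1; rewrite exprS => h; field.
Qed.

(** Summation by parts: [a_(n+1) - b_(n+1) = 2 (b_n - b_(n+1))], so the weights [n] collapse to a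
    plain sum and the boundary term [2 N b_N]. *)
Lemma G_series q N : normc q < 1 ->
  series (fun n => G_coef q n * (- 2) ^+ n) N.+1 =
  2 * series (F1_term q (- 2 * q)) N - 2 * (N%:R * F1_term q (- 2 * q) N).
Proof.
move=> q1; elim: N => [|N IHN].
  by rewrite /series /= big_nat1 big_nil /G_coef !mul0r !mulr0 subr0.
have sS (u : nat -> R[i]) k : series u k.+1 = series u k + u k.
  by rewrite /series /= big_nat_recr.
rewrite [LHS]sS IHN sS.
have -> : G_coef q N.+1 * (- 2) ^+ N.+1 =
    N.+1%:R * (F1_term q (- 2) N.+1 - F1_term q (- 2 * q) N.+1).
  by rewrite !F1_termE /G_coef exprMn; ring.
have -> : F1_term q (- 2) N.+1 = 2 * F1_term q (- 2 * q) N - F1_term q (- 2 * q) N.+1.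
  by rewrite -F1_term_recur // addrK.
by rewrite -(natr1 N); ring.
Qed.

Lemma abs_summable_F1_term q z : normc q < 1 -> abs_summable (F1_term q z).
Proof. by move=> q1; rewrite F1_termE; exact: entire_F1. Qed.

Lemma natr_F1_term_cvg0 q z : normc q < 1 ->
  (fun n => n%:R * F1_term q z n) @ \oo --> (0 : R[i]).
Proof.
move=> q1; apply: abs_summable_cvg0.
apply: (@le_abs_summable _ _ (F1_term q (2 * z))); last first.
  exact: abs_summable_F1_term.
move=> n; rewrite !F1_termE exprMn mulrCA [leRHS](_ : _ =
  normc (2 ^+ n * (F1_coef q n * z ^+ n))); last by rewrite mulrCA.
rewrite mulrCA [leLHS]ComplexField.Normc.normcM [leRHS]ComplexField.Normc.normcM.
rewrite ler_wpM2r ?normc_ge0 // normcX !normc_nat -natrX ler_nat.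
by apply: ltnW; exact: ltn_expl.
Qed.

Lemma psum_G q : normc q < 1 ->
  psum (G_coef q) (- 2) = 2 * F1 q (- 2 * q).
Proof.
move=> q1; have l1 := @psum_cvg _ _ (- 2) (entire_G q1).
apply: cvgc_unique (cvg_comp _ _ (@cvg_addnr 1) l1) _.
have l2 : series (F1_term q (- 2 * q)) @ \oo --> F1 q (- 2 * q).
  exact: (abs_summable_cvg (abs_summable_F1_term (- 2 * q) q1)).
have l3 := @natr_F1_term_cvg0 _ (- 2 * q) q1.
rewrite (_ : _ \o _ = fun N => 2 * series (F1_term q (- 2 * q)) N
    - 2 * (N%:R * F1_term q (- 2 * q) N)).
  rewrite (_ : 2 * F1 _ _ = 2 * F1 q (- 2 * q) - 2 * 0); last by rewrite mulr0 subr0.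
  exact: (cvgB (cvgM (cvg_cst (2 : R[i])) l2) (cvgM (cvg_cst (2 : R[i])) l3)).
by apply/funext => N /=; rewrite addn1 G_series.
Qed.

(** * Passage from bounded to arbitrary parts *)

Lemma cvg_sigmaMex_le q N : normc q < 1 ->
  series (fun n => (sigmaMex_le N n)%:R * q ^+ n) @ \oo -->
  qpoch (- q) q N / qpoch q q N * series (F1_term q (- 2 * q)) N.+1.
Proof.
move=> q1; rewrite (_ : series (fun n => (sigmaMex_le N n)%:R * q ^+ n) =
    fun J => wsum q Mex (ovps N J)).
  exact: cvg_wsum_Mex.
by apply/funext => J; rewrite wsum_MexE.
Qed.

(** At [Q = |q|] all terms are non-negative. The first [J] terms are unchanged by the cutoff [J], so
    their sum is at most the limit of the cut-off series, whose closed form is bounded uniformly in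
    [J]. *)
Lemma abs_summable_sigmaMex q : normc q < 1 ->
  abs_summable (fun n => (sigmaMex n)%:R * q ^+ n).
Proof.
move=> q1; pose Q : R[i] := (normc q)%:C%C.
have nQ : normc Q = normc q by rewrite normc_real ger0_norm ?normc_ge0.
have Q1 : normc Q < 1 by rewrite nQ.
have [B1 pB1] := normc_prod_bounded (abs_summable_qpoch (- Q) Q1).
have [B2 pB2] := normc_prod_bounded (abs_summable_qpochV Q1).
have [B3 pB3] := abs_summable_F1_term (- 2 * Q) Q1.
exists (B1 * B2 * B3) => J.
have h : normc (series (fun n => (sigmaMex_le J n)%:R * Q ^+ n) K) @[K --> \oo] -->
    normc (qpoch (- Q) Q J / qpoch Q Q J * series (F1_term Q (- 2 * Q)) J.+1).
  by apply: cvgc_norm; exact: cvg_sigmaMex_le.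
apply: (@le_trans _ _
    (normc (qpoch (- Q) Q J / qpoch Q Q J * series (F1_term Q (- 2 * Q)) J.+1))).
  pose S K := \sum_(0 <= n < K) (sigmaMex_le J n)%:R * normc q ^+ n.
  have SE : (fun K => normc (series (fun n => (sigmaMex_le J n)%:R * Q ^+ n) K)) = S.
    apply/funext => K; rewrite /S /series /=.
    rewrite (_ : \sum_(0 <= k < K) _ = (S K)%:C%C).
      rewrite normc_real ger0_norm // sumr_ge0 // => n _.
      by rewrite mulr_ge0 ?exprn_ge0 ?normc_ge0.
    rewrite /S rmorph_sum /=; apply: eq_bigr => n _.
    by rewrite rmorphM rmorphXn rmorph_nat.
  rewrite SE in h.
  have -> : \sum_(0 <= k < J) normc ((sigmaMex k)%:R * q ^+ k) = S J.
    apply: eq_big_nat => k /andP[_ kJ]; rewrite sigmaMex_le_eq ?(ltnW kJ) //.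
    by rewrite ComplexField.Normc.normcM normc_nat normcX.
  rewrite -(cvg_lim _ h) //; apply: nondecreasing_cvgn_le.
    by apply: sum_nondecreasing => n; rewrite mulr_ge0 ?exprn_ge0 ?normc_ge0.
  by apply/cvg_ex; eexists; exact: h.
rewrite !ComplexField.Normc.normcM; apply: ler_pM; rewrite ?mulr_ge0 ?normc_ge0 //.
  apply: ler_pM; rewrite ?normc_ge0 //.
    by rewrite qpochE; exact: pB1.
  by rewrite qpochVE.
by apply: le_trans (le_normc_sum _ _ _) _; exact: pB3.
Qed.

End GeneratingFunction.

Theorem theorem1p9 (R : realType) (q : R[i]) (hq : `|q| < 1) :
  let G : R[i] -> R[i] := fun z =>
    z * (derive1 (F1 q) z - q * derive1 (F1 q) (q * z)) in
  cvg (G z @[z --> (- 2 : R[i])^'])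
  /\ series (fun n => (sigmaMex n)%:R * q ^+ n) @ \oo -->
     qpoch_inf (- q) q / (2 * qpoch_inf q q) *
       lim (G z @[z --> (- 2 : R[i])^']).
Proof.
move=> G; have q1 : normc q < 1 by rewrite normrE ltcR in hq.
have G_cvg : G z @[z --> (- 2 : R[i])^'] --> 2 * F1 q (- 2 * q).
  (* [G] is entire, so its punctured limit at -2 is its value there. *)
  rewrite (_ : G = psum (G_coef q)); last by apply/funext => z; exact: G_psum.
  rewrite -psum_G //; apply: cvg_within_filter; apply: psum_continuous.
  exact: entire_G.
split; first by apply/cvg_ex; exists (2 * F1 q (- 2 * q)).
rewrite (cvgc_lim G_cvg).
have := qpoch_inf_neq0 q1 => h0.
rewrite (_ : _ * _ = qpoch_inf (- q) q / qpoch_inf q q * F1 q (- 2 * q)); last by field.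
(* Here [l N] is the closed form for parts at most [N]; it converges because [(q;q)_oo] is non-zero
   and the partial sums of [F1] at [- 2 * q] converge. *)
apply: (tannery (a := fun N n => (sigmaMex_le N n)%:R * q ^+ n)
  _ _ (abs_summable_sigmaMex q1)).
- by move=> N n nN; rewrite sigmaMex_le_eq // ltnW.
- move=> N n; rewrite !ComplexField.Normc.normcM !normc_nat.
  by rewrite ler_wpM2r ?normc_ge0 // ler_nat sigmaMex_le_leq.
- by move=> N; exact: cvg_sigmaMex_le.
have qV : (fun N => (qpoch q q N)^-1) @ \oo --> (qpoch_inf q q)^-1.
  exact: (cvgV h0 (@cvg_qpoch _ q q q1)).
have F1S : (fun N => series (F1_term q (- 2 * q)) N.+1) @ \oo --> F1 q (- 2 * q).
  apply: (cvg_comp _ _ (@cvg_addnl 1)).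
  exact: (abs_summable_cvg (abs_summable_F1_term (- 2 * q) q1)).
exact: (cvgM (cvgM (@cvg_qpoch _ (- q) q q1) qV) F1S).
Qed.
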